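(* Let $R$ be an iterated local skew power series ring in the ordered list of variables $x_1,\dots,x_n$ of type (A) or (B), and let $\preceq$ be a monomial order on $R$. Suppose $I$ is a left ideal of $R$ with Gröbner basis $G$, and let $f\in R$ be arbitrary. Then $f\in I$ if and only if $\overline{f}^G=0$, where $\overline{f}^G$ denotes the remainder when $f$ is right-divided by $G$.
   Context: $\mathbb{N}$ contains $0$. A skew derivation on a ring $B$ is a pair $(\sigma,\delta)$ with $\sigma$ an automorphism of $B$ and $\delta:B\to B$ additive with $\delta(rs)=\delta(r)s+\sigma(r)\delta(s)$. If $(B,\mathfrak m)$ is a complete local ring, $(\sigma,\delta)$ is local if $\sigma(\mathfrak m^i)=\mathfrak m^i$ and $\delta(\mathfrak m^i)\subseteq\mathfrak m^{i+1}$ for all $i\ge 0$; then the skew power series ring $B[[x;\sigma,\delta]]$ exists: it is the left $B$-module of formal power series $\sum_j b_jx^j$ with the continuous multiplication extending $xr=\sigma(r)x+\delta(r)$ $(r\in B)$, and it is again complete local. If $A\subseteq B$ is a subring, $(\sigma,\delta)$ is $A$-linear if $\sigma(a)=a$ and $\delta(a)=0$ for all $a\in A$. The ring $R$ is one of the following. Case (A): $A=k$ is a finite field of characteristic $p$, $R_0=A$, and for $1\le i\le n$, $R_i=R_{i-1}[[x_i;\sigma_i,\delta_i]]$ with $(\sigma_i,\delta_i)$ a local, $A$-linear skew derivation on $R_{i-1}$. Put $R=R_n$. Case (B): $A$ is a (commutative) complete discrete valuation ring of characteristic $0$, not a field, with residue field $k$ a finite field of characteristic $p$; $x_1$ is a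 fixed uniformiser of $A$; $R_1=A$, and for $2\le i\le n$, $R_i=R_{i-1}[[x_i;\sigma_i,\delta_i]]$ with $(\sigma_i,\delta_i)$ a local, $A$-linear skew derivation on $R_{i-1}$. Put $R=R_n$. Let $\iota:k\to A$ be the unique multiplicative section of $A\to k$ (the identity in case (A)). For $\alpha\in\mathbb{N}^n$ write $x^\alpha=x_1^{\alpha_1}\cdots x_n^{\alpha_n}$. Every $r\in R$ is uniquely $r=\sum_{\alpha\in\mathbb{N}^n}r_\alpha x^\alpha$ with $r_\alpha\in\iota(k)$; $\mathrm{supp}(r)=\{\alpha:r_\alpha\ne0\}$. An additive total order on $\mathbb{N}^n$ is a total order with $0\prec\alpha$ for all $\alpha\neq 0$, and $\alpha\prec\beta\Rightarrow\alpha+\gamma\prec\beta+\gamma$ (it is automatically a well-order). For $r\ne0$, $\mathrm{LM}(r)=\min_\preceq\mathrm{supp}(r)$. A monomial order on $R$ is an additive total order $\preceq$ with $\mathrm{LM}_\preceq(x^\alpha x^\beta)=\alpha+\beta$ for all $\alpha,\beta\in\mathbb{N}^n$. For $S\subseteq R$ (or a tuple $S$ of elements of $R$), $\mathrm{LM}(S)=\{\mathrm{LM}(s):s\in S\setminus\{0\}\}$; for $T\subseteq\mathbb{N}^n$, $\langle T\rangle=\bigcup_{t\in T}(t+\mathbb{N}^n)$. A left ideal basis for a left ideal $I$ is a finite ordered tuple $G=(g_1,\dots,g_s)$ of nonzero elements of $I$ with $I=Rg_1+\dots+Rg_s$; it is a Gröbner basis for $I$ if $\mathrm{LM}(I)=\langle\mathrm{LM}(G)\rangle$.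 Right-division: for a tuple $G=(g_1,\dots,g_s)$ of nonzero elements put $\Delta_{G,r}=(\mathrm{LM}(g_r)+\mathbb{N}^n)\setminus\bigcup_{i<r}\Delta_{G,i}$ and $\overline\Delta_G=\mathbb{N}^n\setminus\bigcup_{i=1}^s\Delta_{G,i}$. Every $f\in R$ is uniquely $f=q_1g_1+\dots+q_sg_s+r$ with $\mathrm{supp}(q_i)+\mathrm{LM}(g_i)\subseteq\Delta_{G,i}$ for all $i$ and $\mathrm{supp}(r)\subseteq\overline\Delta_G$; the remainder is $\overline f^G:=r$. *)

(* Defs.v *)
From HB Require Import structures.
From mathcomp Require Import all_boot all_order all_algebra.
From mathcomp Require Import boolp classical_sets.

Set Implicit Arguments.
Unset Strict Implicit.
Unset Printing Implicit Defensive.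

Import GRing.Theory.
Local Open Scope classical_set_scope.
Local Open Scope ring_scope.

(* The rings are not assumed commutative.  [unitRingType] only serves to have  *)
(* the predicate [GRing.unit] of two-sided invertible elements.               *)

(** * Complete local rings *)

(* In a local ring the maximal ideal is the set of nonunits. *)
Definition maxideal (B : unitRingType) : set B :=
  [set r | r \isn't a GRing.unit].

Definition local_ring (B : unitRingType) : Prop :=
  forall a b : B, maxideal a -> maxideal b -> maxideal (a + b).

(* I^0 is the whole ring; I^(i+1) consists of the finite sums of products      *)
(* a * b with a in I and b in I^i.                                            *)
Fixpoint ideal_pow (B : unitRingType) (I : set B) (i : nat) : set B :=
  if i is j.+1 then
    [set r | exists2 s : seq (B * B),
       (forall u, u \in s -> I u.1 /\ ideal_pow I j u.2) &
       r = \sum_(u <- s) u.1 * u.2]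
  else setT.

Definition mpow (B : unitRingType) : nat -> set B :=
  ideal_pow (@maxideal B).
Arguments mpow : clear implicits.

(* The canonical map from B to the inverse limit of the B / m^i is injective   *)
(* and surjective.                                                            *)
Definition adically_complete (B : unitRingType) : Prop :=
  (forall r : B, (forall i, mpow B i r) -> r = 0) /\
  (forall u : nat -> B, (forall i, mpow B i (u i.+1 - u i)) ->
     exists l : B, forall i, mpow B i (l - u i)).

Definition complete_local_ring (B : unitRingType) : Prop :=
  local_ring B /\ adically_complete B.

(** * Skew derivations and skew power series rings *)

Record skew_derivation (B : unitRingType)
    (sigma : {rmorphism B -> B}) (delta : {additive B -> B}) : Prop := {
  sd_bij : bijective sigma;
  sd_leibniz : forall r s : B,
    delta (r * s) = delta r * s + sigma r * delta s }.

Definition local_skew_derivation (B : unitRingType)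
    (sigma : {rmorphism B -> B}) (delta : {additive B -> B}) : Prop :=
  [/\ complete_local_ring B,
      skew_derivation sigma delta,
      forall i, sigma @` mpow B i = mpow B i &
      forall i, delta @` mpow B i `<=` mpow B i.+1].

(* The subring A of B is given by its inclusion f. *)
Definition linear_skew_derivation (A B : unitRingType) (f : {rmorphism A -> B})
    (sigma : {rmorphism B -> B}) (delta : {additive B -> B}) : Prop :=
  forall a : A, sigma (f a) = f a /\ delta (f a) = 0.

(* Basic neighbourhoods of 0 in B^nat for the product of the m-adic topologies *)
Definition series_nbhs0 (B : unitRingType) (N : nat) : set (nat -> B) :=
  [set b | forall j, (j < N)%N -> mpow B N (b j)].

(* [S], with the inclusion [f : B -> S] and the variable [y], is               *)
(* B[[y; sigma, delta]]: [coef] identifies the left B-module S with that of    *)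
(* all formal series sum_j b_j y^j, and the multiplication is (jointly)        *)
(* continuous and extends y b = sigma(b) y + delta(b).  As polynomials in y    *)
(* are dense, this determines S up to isomorphism.                            *)
Record skew_power_series_ring (B S : unitRingType)
    (sigma : {rmorphism B -> B}) (delta : {additive B -> B})
    (f : {rmorphism B -> S}) (y : S) (coef : S -> nat -> B) : Prop := {
  sps_bij : bijective coef;
  sps_add : forall s t j, coef (s + t) j = coef s j + coef t j;
  sps_scale : forall b s j, coef (f b * s) j = b * coef s j;
  sps_var : forall i j, coef (y ^+ i) j = (i == j)%:R;
  sps_comm : forall b, y * f b = f (sigma b) * y + f (delta b);
  sps_continuous : forall s t N, exists M, forall s' t',
    series_nbhs0 M (coef (s' - s)) -> series_nbhs0 M (coef (t' - t)) ->
    series_nbhs0 N (coef (s' * t' - s * t)) }.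

(* [iterated f ys]: starting from A, the target S of [f : A -> S] is obtained  *)
(* by successively adjoining the variables in [ys] by local A-linear skew      *)
(* derivations.                                                               *)
Inductive iterated (A : unitRingType) :
    forall S : unitRingType, {rmorphism A -> S} -> seq S -> Prop :=
| iterated_nil : iterated (idfun : {rmorphism A -> A}) [::]
| iterated_rcons (B S : unitRingType) (f : {rmorphism A -> B}) (ys : seq B)
    (sigma : {rmorphism B -> B}) (delta : {additive B -> B})
    (g : {rmorphism B -> S}) (y : S) (coef : S -> nat -> B) :
    iterated f ys ->
    local_skew_derivation sigma delta ->
    linear_skew_derivation f sigma delta ->
    skew_power_series_ring sigma delta g y coef ->
    iterated (g \o f : {rmorphism A -> S}) (rcons [seq g z | z <- ys] y).

(** * The coefficient rings *)

(* A discrete valuation ring: a local principal ideal domain, not a field. *)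
Definition ideal (A : idomainType) (J : set A) : Prop :=
  [/\ J 0, forall a b, J a -> J b -> J (a + b) &
      forall a b, J b -> J (a * b)].

Definition principal_ideal (A : idomainType) (a : A) : set A :=
  [set b | exists c, b = c * a].

Record discrete_valuation_ring (A : idomainType) : Prop := {
  dvr_local : local_ring A;
  dvr_principal : forall J : set A, ideal J -> exists a, J = principal_ideal a;
  dvr_not_field : exists2 a : A, a != 0 & maxideal a }.

Definition uniformiser (A : idomainType) (a : A) : Prop :=
  @maxideal A = principal_ideal a.

(* rho exhibits k as the residue field of A *)
Definition residue_map (A : idomainType) (k : fieldType)
    (rho : {rmorphism A -> k}) : Prop :=
  (forall c, exists a, rho a = c) /\ (forall a, rho a = 0 <-> maxideal a).

Definition multiplicative_section (A : idomainType) (k : fieldType)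
    (rho : {rmorphism A -> k}) (iota : k -> A) : Prop :=
  cancel iota rho /\ {morph iota : c d / c * d}.

(* R is of type (A) or (B), [x] is its ordered list of variables, and [e] is   *)
(* the composite of iota : k -> A and the inclusion of A in R.                *)
Variant iterated_local_skew_power_series_ring (p : nat) (k : finFieldType) :
    forall R : unitRingType, (k -> R) -> seq R -> Prop :=
| type_A (R : unitRingType) (f : {rmorphism k -> R}) (x : seq R) :
    p \in [pchar k] ->
    iterated f x ->
    iterated_local_skew_power_series_ring p f x
| type_B (A : idomainType) (rho : {rmorphism A -> k}) (iota : k -> A) (x1 : A)
    (R : unitRingType) (f : {rmorphism A -> R}) (x : seq R) :
    p \in [pchar k] ->
    [pchar A] =i pred0 ->
    discrete_valuation_ring A ->
    complete_local_ring A ->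
    uniformiser x1 ->
    residue_map rho ->
    multiplicative_section rho iota ->
    iterated f x ->
    iterated_local_skew_power_series_ring p (f \o iota) (f x1 :: x).

(** * Monomials, supports, leading monomials *)

(* N^n, with pointwise addition *)
Notation multi n := {ffun 'I_n -> nat}.

Definition monomial (R : unitRingType) (n : nat) (x : n.-tuple R)
    (alpha : multi n) : R :=
  \prod_(i < n) tnth x i ^+ alpha i.

(* r = sum_alpha e(c_alpha) x^alpha, as an unconditionally convergent sum in   *)
(* the m-adic topology of R                                                   *)
Definition expansion (k : finFieldType) (R : unitRingType) (n : nat)
    (e : k -> R) (x : n.-tuple R) (r : R) (c : multi n -> k) : Prop :=
  forall N, exists s0 : seq (multi n), forall s : seq (multi n),
    uniq s -> {subset s0 <= s} ->
    mpow R N (r - \sum_(alpha <- s) e (c alpha) * monomial x alpha).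

Definition coefficient (k : finFieldType) (R : unitRingType) (n : nat)
    (e : k -> R) (x : n.-tuple R) (r : R) (alpha : multi n) : k :=
  xget 0 [set d | exists2 c, expansion e x r c & d = c alpha].

Definition supp (k : finFieldType) (R : unitRingType) (n : nat)
    (e : k -> R) (x : n.-tuple R) (r : R) : set (multi n) :=
  [set alpha | coefficient e x r alpha != 0].

Definition strict (n : nat) (le : rel (multi n)) : rel (multi n) :=
  fun alpha beta => (alpha != beta) && le alpha beta.

Record additive_total_order (n : nat) (le : rel (multi n)) : Prop := {
  ato_refl : reflexive le;
  ato_anti : antisymmetric le;
  ato_trans : transitive le;
  ato_total : total le;
  ato_gt0 : forall alpha, alpha != 0 -> strict le 0 alpha;
  ato_add : forall alpha beta gamma,
    strict le alpha beta -> strict le (alpha + gamma) (beta + gamma) }.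

(* Only meaningful for r != 0; the default value 0 is irrelevant. *)
Definition LM (k : finFieldType) (R : unitRingType) (n : nat)
    (e : k -> R) (x : n.-tuple R) (le : rel (multi n)) (r : R) : multi n :=
  xget 0 [set alpha | supp e x r alpha /\
                      forall beta, supp e x r beta -> le alpha beta].

Definition monomial_order (k : finFieldType) (R : unitRingType) (n : nat)
    (e : k -> R) (x : n.-tuple R) (le : rel (multi n)) : Prop :=
  additive_total_order le /\
  forall alpha beta : multi n,
    LM e x le (monomial x alpha * monomial x beta) = alpha + beta.

Definition LMset (k : finFieldType) (R : unitRingType) (n : nat)
    (e : k -> R) (x : n.-tuple R) (le : rel (multi n)) (S : set R) :
    set (multi n) :=
  LM e x le @` (S `\ 0).

(* the union of the t + N^n for t in T *)
Definition upclosure (n : nat) (T : set (multi n)) : set (multi n) :=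
  [set alpha | exists2 t, T t & exists gamma, alpha = t + gamma].

(** * Left ideals, Groebner bases, right division *)

Record left_ideal (R : unitRingType) (I : set R) : Prop := {
  li_0 : I 0;
  li_add : forall a b, I a -> I b -> I (a + b);
  li_mul : forall a b, I b -> I (a * b) }.

Definition left_ideal_basis (R : unitRingType) (I : set R) (s : nat)
    (G : s.-tuple R) : Prop :=
  (forall i, I (tnth G i) /\ tnth G i != 0) /\
  I = [set r | exists q : 'I_s -> R, r = \sum_(i < s) q i * tnth G i].

Definition groebner_basis (k : finFieldType) (R : unitRingType) (n : nat)
    (e : k -> R) (x : n.-tuple R) (le : rel (multi n)) (I : set R) (s : nat)
    (G : s.-tuple R) : Prop :=
  left_ideal_basis I G /\
  LMset e x le I = upclosure (LMset e x le [set` G]).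

(* The regions Delta_{G,i} listed in order, with U the union of the regions    *)
(* already constructed.                                                       *)
Fixpoint regions (n : nat) (U : set (multi n)) (ms : seq (multi n)) :
    seq (set (multi n)) :=
  if ms is m :: ms' then
    let D := upclosure [set m] `\` U in D :: regions (U `|` D) ms'
  else [::].

Definition Delta (k : finFieldType) (R : unitRingType) (n : nat)
    (e : k -> R) (x : n.-tuple R) (le : rel (multi n)) (s : nat)
    (G : s.-tuple R) (i : 'I_s) : set (multi n) :=
  nth set0 (regions set0 [seq LM e x le g | g <- G]) i.

Definition Delta_bar (k : finFieldType) (R : unitRingType) (n : nat)
    (e : k -> R) (x : n.-tuple R) (le : rel (multi n)) (s : nat)
    (G : s.-tuple R) : set (multi n) :=
  ~` \bigcup_(i in [set: 'I_s]) Delta e x le G i.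

Definition right_division (k : finFieldType) (R : unitRingType) (n : nat)
    (e : k -> R) (x : n.-tuple R) (le : rel (multi n)) (s : nat)
    (G : s.-tuple R) (f : R) (q : 'I_s -> R) (r : R) : Prop :=
  [/\ f = \sum_(i < s) q i * tnth G i + r,
      forall i alpha, supp e x (q i) alpha ->
        Delta e x le G i (alpha + LM e x le (tnth G i)) &
      supp e x r `<=` Delta_bar e x le G].

(* The r of the division of f by G, which exists and is unique when the        *)
(* entries of G are nonzero and [le] is a monomial order.                     *)
Definition remainder (k : finFieldType) (R : unitRingType) (n : nat)
    (e : k -> R) (x : n.-tuple R) (le : rel (multi n)) (s : nat)
    (G : s.-tuple R) (f : R) : R :=
  xget 0 [set r | exists q, right_division e x le G f q r].

(* Main.v *)
Require Import Defs.
From HB Require Import structures.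
From mathcomp Require Import all_boot all_order all_algebra.
From mathcomp Require Import boolp classical_sets.
From mathcomp Require Import zify ring.

(* Every r in R is determined by its digit function N^n -> k, and every        *)
(* function is the digit function of some r.  Adding two elements may produce  *)
(* carries (in type (B)), but a carry only moves to larger exponents, so the   *)
(* elements supported in an up-closed set U of exponents form a subgroup, and  *)
(* this subgroup is closed for the topology of the maximal ideal.  Hence       *)
(* LM(r s) >= LM(r) + LM(s) reduces to the case of monomials r and s.          *)
(*                                                                            *)
(* A candidate division f = q_1 g_1 + ... + q_s g_s + r is encoded by a single *)
(* function h : N^n -> k, since the regions Delta_i and the complement of      *)
(* their union partition N^n.  Changing h from alpha onwards changes the right *)
(* hand side only from alpha onwards, and changing h at alpha changes its      *)
(* coefficient at alpha in an invertible way.  As the order is a well-order    *)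
(* (Dickson), h is found by transfinite recursion; no limits are needed.       *)
(* If f lies in I, so does the remainder r; were r nonzero, LM(r) would lie in *)
(* LM(I), the union of the Delta_i, and also outside of it.                    *)

Set Implicit Arguments.
Unset Strict Implicit.
Unset Printing Implicit Defensive.

Import GRing.Theory.
Local Open Scope classical_set_scope.
Local Open Scope ring_scope.

(** * Powers of the maximal ideal of a local ring *)

(** If [f] is in [I], so is its remainder [r], as all the generators are. A nonzero [r] would have
    its leading exponent in LM(I), hence divisible by the leading exponent of some generator, while
    the support of [r] avoids all such multiples. Conversely, a zero remainder displays [f] as a
    combination of [G]. The real work is the existence of a division ([right_division_exists]),
    which makes [remainder] more than a default value.

    What the rings of types (A) and (B) share is recorded in [digit_system]. It holds for a finite
    field and for a complete DVR ([digit_system_field], [digit_system_dvr]) and passes from [B] to a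
    skew power series ring over [B] ([digit_system_series]), where [mpow_filt] computes the powers
    of the maximal ideal coefficientwise. [expansionP] identifies digits with the coefficients of
    the convergent expansion. Leading terms are controlled by [supported_agree], [supportedM] and
    [monomial_mul_lead]; [combination_update] and [division_digit_spec] then build the division one
    exponent at a time. *)

Section LocalRing.
Variable (B : unitRingType).
Hypothesis locB : local_ring B.
Implicit Types a b r s : B.

Lemma maxideal0 : maxideal (0 : B).
Proof. by rewrite /maxideal /= unitr0. Qed.

Lemma maxideal1 : ~ maxideal (1 : B).
Proof. by rewrite /maxideal /= unitr1. Qed.

(** The element [b * a] is idempotent, and it or [1 - b * a] is a unit because the ring is local. So
    [b * a] is 1, or it is 0 and then 1 = (ab)(ab) = 0. Excluding one-sided inverses is what makes
    the nonunits a two-sided ideal. *)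
Lemma local_unit_left_inv a b : a * b = 1 -> b \is a GRing.unit.
Proof.
move=> ab1; apply/negPn/negP => nb.
have [uba|nba] := boolP (b * a \is a GRing.unit).
  suff ba1 : b * a = 1 by move/negP: nb; apply; apply/unitrP; exists a.
  have id : (b * a) * (b * a) = b * a * 1 by rewrite mulrA -(mulrA b) ab1 !mulr1.
  by move: (mulrI uba id).
have u1 : 1 - b * a \is a GRing.unit.
  apply/negPn/negP => n1; apply: maxideal1.
  by rewrite -(subrK (b * a) 1); apply: locB.
have id : (1 - b * a) * (1 - b * a) = (1 - b * a) * 1.
  rewrite mulr1 mulrBr mulr1 mulrBl mul1r mulrA -(mulrA b) ab1 mulr1 subrr.
  by rewrite subr0.
have /eqP := mulrI u1 id.
rewrite -subr_eq0 addrAC subrr sub0r oppr_eq0 => /eqP ba0.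
have /eqP : (1 : B) = 0.
  by rewrite -[1]mulr1 -{1}ab1 -ab1 mulrA -(mulrA a) ba0 mulr0 mul0r.
by rewrite oner_eq0.
Qed.

Lemma local_unit_right_inv a b : a * b = 1 -> a \is a GRing.unit.
Proof.
move=> ab1; have ub := local_unit_left_inv ab1.
suff -> : a = b^-1 by rewrite unitrV.
by apply: (mulIr ub); rewrite ab1 mulVr.
Qed.

Lemma maxideal_mull a r : maxideal r -> maxideal (a * r).
Proof.
rewrite /maxideal /= => nr; apply/negP => u; move/negP: nr; apply.
by apply: (@local_unit_left_inv ((a * r)^-1 * a)); rewrite -mulrA mulVr.
Qed.

Lemma maxideal_mulr a r : maxideal r -> maxideal (r * a).
Proof.
rewrite /maxideal /= => nr; apply/negP => u; move/negP: nr; apply.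
by apply: (@local_unit_right_inv _ (a * (r * a)^-1)); rewrite mulrA mulrV.
Qed.

Lemma mpow0 N : mpow B N 0.
Proof. by case: N => [|N] //=; exists [::] => //; rewrite big_nil. Qed.

Lemma mpowD N r s : mpow B N r -> mpow B N s -> mpow B N (r + s).
Proof.
case: N => [|N] //= [u Iu ->] [v Iv ->]; exists (u ++ v); last by rewrite big_cat.
by move=> w; rewrite mem_cat => /orP[/Iu|/Iv].
Qed.

Lemma mpow_sum N (T : eqType) (w : seq T) (F : T -> B) :
  (forall i, i \in w -> mpow B N (F i)) -> mpow B N (\sum_(i <- w) F i).
Proof.
move=> IF; rewrite big_seq.
by elim/big_ind: _ => //; [exact: mpow0 | exact: mpowD].
Qed.

Lemma mpow_mull N a r : mpow B N r -> mpow B N (a * r).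
Proof.
case: N => [|N] //= [u Iu ->]; exists [seq (a * w.1, w.2) | w <- u].
  by move=> _ /mapP[w /Iu[w1 w2] ->] /=; split=> //; exact: maxideal_mull.
by rewrite big_map mulr_sumr; apply: eq_bigr => i _; rewrite mulrA.
Qed.

Lemma mpow_mulr N a r : mpow B N r -> mpow B N (r * a).
Proof.
elim: N r => [|N IH] r //= [u Iu ->]; exists [seq (w.1, w.2 * a) | w <- u].
  by move=> _ /mapP[w /Iu[w1 w2] ->] /=; split=> //; exact: IH.
by rewrite big_map mulr_suml; apply: eq_bigr => i _; rewrite mulrA.
Qed.

Lemma mpowN N r : mpow B N r -> mpow B N (- r).
Proof. by move=> Ir; rewrite -mulN1r; exact: mpow_mull. Qed.

Lemma mpowB N r s : mpow B N r -> mpow B N s -> mpow B N (r - s).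
Proof. by move=> Ir Is; apply: mpowD => //; exact: mpowN. Qed.

Lemma mpowM M N r s : mpow B M r -> mpow B N s -> mpow B (M + N) (r * s).
Proof.
elim: M r => [|M IH] r /= ; first by move=> _; exact: mpow_mull.
move=> [u Iu ->] Is; exists [seq (w.1, w.2 * s) | w <- u].
  by move=> _ /mapP[w /Iu[w1 w2] ->] /=; split=> //; exact: IH.
by rewrite big_map mulr_suml; apply: eq_bigr => i _; rewrite mulrA.
Qed.

Lemma mpow_leq M N r : (M <= N)%N -> mpow B N r -> mpow B M r.
Proof.
move=> /subnK <-; elim: (N - M)%N r => [|d IH] r //= [u Iu ->].
apply: IH; apply: mpow_sum => w /Iu[_]; exact: mpow_mull.
Qed.

Lemma mpow1 r : mpow B 1 r <-> maxideal r.
Proof.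
split=> [[u Iu ->]|Ir].
  rewrite big_seq; elim/big_ind: _ => //; first exact: maxideal0.
  by move=> w /Iu[w1 _]; exact: maxideal_mulr.
exists [:: (r, 1)]; last by rewrite big_seq1 mulr1.
by move=> w; rewrite inE => /eqP ->.
Qed.

End LocalRing.

(** * The maximal ideal of a skew power series ring *)

Section SkewPowerSeries.
Variables (B S : unitRingType) (sigma : {rmorphism B -> B}).
Variables (delta : {additive B -> B}) (g : {rmorphism B -> S}) (y : S).
Variable (coef : S -> nat -> B).
Hypothesis lsd : local_skew_derivation sigma delta.
Hypothesis sps : skew_power_series_ring sigma delta g y coef.
Implicit Types s t u v : S.

Let locB : local_ring B.
Proof. by case: lsd => -[]. Qed.

Lemma mpow_separated (r : B) : (forall N, mpow B N r) -> r = 0.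
Proof. by case: lsd => -[_ [H _]] _ _ _; exact: H. Qed.

Lemma mpow_sigma N b : mpow B N b -> mpow B N (sigma b).
Proof. by case: lsd => _ _ H _ Ib; rewrite -H; exists b. Qed.

Lemma mpow_delta N b : mpow B N b -> mpow B N.+1 (delta b).
Proof. by case: lsd => _ _ _ H Ib; apply: H; exists b. Qed.

Lemma coef_inj : injective coef. Proof. exact: bij_inj (sps_bij sps). Qed.

Lemma coef0 j : coef 0 j = 0.
Proof. by apply: (addrI (coef 0 j)); rewrite -(sps_add sps) !addr0. Qed.

Lemma coefN s j : coef (- s) j = - coef s j.
Proof. by apply: (addrI (coef s j)); rewrite -(sps_add sps) !subrr coef0. Qed.

Lemma coefB s t j : coef (s - t) j = coef s j - coef t j.
Proof. by rewrite (sps_add sps) coefN. Qed.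

Lemma coef_sum (T : Type) (w : seq T) (P : pred T) (F : T -> S) j :
  coef (\sum_(i <- w | P i) F i) j = \sum_(i <- w | P i) coef (F i) j.
Proof.
apply: (big_morph (coef^~ j)); [exact: (fun s t => sps_add sps s t j)|].
exact: coef0.
Qed.

Lemma coef_term b i j : coef (g b * y ^+ i) j = if i == j then b else 0.
Proof.
by rewrite (sps_scale sps) (sps_var sps); case: eqP; rewrite ?mulr1 ?mulr0.
Qed.

Lemma coef_const b j : coef (g b) j = if j == 0%N then b else 0.
Proof. by rewrite -[g b]mulr1 -(expr0 y) coef_term eq_sym. Qed.

Definition trunc M s := \sum_(j < M) g (coef s j) * y ^+ j.

Lemma coef_trunc M s j : coef (trunc M s) j = if (j < M)%N then coef s j else 0.
Proof.
rewrite coef_sum; have [jM|Mj] := ltnP j M.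
  rewrite (bigD1 (Ordinal jM)) //= coef_term eqxx big1 ?addr0 // => i.
  by rewrite coef_term -val_eqE /= => /negbTE ->.
rewrite big1 // => i _; rewrite coef_term; case: eqP => // ij.
by have := ltn_ord i; rewrite ij ltnNge Mj.
Qed.

Lemma trunc_near M N s : (N <= M)%N -> series_nbhs0 N (coef (trunc M s - s)).
Proof.
move=> NM j jN; rewrite coefB coef_trunc (leq_trans jN NM) subrr; exact: mpow0.
Qed.

Lemma near0 M s : series_nbhs0 M (coef (s - s)).
Proof. by move=> j _; rewrite subrr coef0; exact: mpow0. Qed.

(* [filt N] turns out to be the N-th power of the maximal ideal of S. *)
Definition filt N : set S := [set s | forall j, mpow B (N - j) (coef s j)].

Lemma filt0 s : filt 0 s. Proof. by []. Qed.

Lemma filt_zero N : filt N 0.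
Proof. by move=> j; rewrite coef0; exact: mpow0. Qed.

Lemma filtD N s t : filt N s -> filt N t -> filt N (s + t).
Proof. by move=> Fs Ft j; rewrite (sps_add sps); apply: mpowD. Qed.

Lemma filtN N s : filt N s -> filt N (- s).
Proof. by move=> Fs j; rewrite coefN; apply: mpowN. Qed.

Lemma filt_sum N (T : Type) (w : seq T) (P : pred T) (F : T -> S) :
  (forall i, P i -> filt N (F i)) -> filt N (\sum_(i <- w | P i) F i).
Proof. by move=> FF; elim/big_ind: _ => //; [exact: filt_zero|exact: filtD]. Qed.

Lemma filt_leq M N s : (M <= N)%N -> filt N s -> filt M s.
Proof. by move=> MN Fs j; apply: mpow_leq (Fs j) => //; rewrite leq_sub2r. Qed.

(** Membership at index [j] involves only [coef s j] modulo the power [N - j], so it survives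
    limits. By continuity, products may therefore be tested on truncations. *)
Lemma filt_closed N s :
  (forall M, exists2 t, filt N t & series_nbhs0 M (coef (t - s))) -> filt N s.
Proof.
move=> H j; have [t Ft] := H (maxn N j.+1).
move=> /(_ j); rewrite leq_maxr coefB => /(_ isT) near.
rewrite -[coef s j](subKr (coef t j)); apply: mpowB => //.
by apply: mpow_leq near => //; lia.
Qed.

Lemma filt_term N b j : mpow B (N - j) b -> filt N (g b * y ^+ j).
Proof.
by move=> Ib i; rewrite coef_term; case: eqP => [<-//|_]; exact: mpow0.
Qed.

Lemma filt_scale M N b s : mpow B M b -> filt N s -> filt (M + N) (g b * s).
Proof.
move=> Ib Fs j; rewrite (sps_scale sps).
by apply: mpow_leq (mpowM locB Ib (Fs j)) => //; lia.
Qed.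

(** On a term, y b y^j = sigma(b) y^(j+1) + delta(b) y^j: the first summand gains a factor [y], the
    second a power of the maximal ideal because [delta] is local. *)
Lemma filt_var N s : filt N s -> filt N.+1 (y * s).
Proof.
move=> Fs; apply: filt_closed => M.
have [K HK] := sps_continuous sps y s M.
exists (y * trunc K s); last first.
  by apply: HK; [exact: near0|exact: trunc_near].
rewrite mulr_sumr; apply: filt_sum => j _.
rewrite mulrA (sps_comm sps) mulrDl -mulrA -exprS; apply: filtD; apply: filt_term.
  exact/mpow_sigma/Fs.
by apply: mpow_leq (mpow_delta (Fs j)) => //; lia.
Qed.

Lemma filt_varX N i s : filt N s -> filt (i + N) (y ^+ i * s).
Proof.
by move=> Fs; elim: i => [|i IH]; rewrite ?mul1r // exprS -mulrA; exact: filt_var.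
Qed.

(** A term b y^j of [s] contributes [M - j] through [b] and [j] through the power of [y] that stands
    to the left of [t]. *)
Lemma filtM M N s t : filt M s -> filt N t -> filt (M + N) (s * t).
Proof.
move=> Fs Ft; apply: filt_closed => K.
have [L HL] := sps_continuous sps s t K.
exists (trunc L s * t); last by apply: HL; [exact: trunc_near|exact: near0].
rewrite mulr_suml; apply: filt_sum => j _; rewrite -mulrA.
by apply: filt_leq (filt_scale (Fs j) (filt_varX j Ft)); lia.
Qed.

Lemma filt_separated s : (forall N, filt N s) -> s = 0.
Proof.
move=> Fs; apply: coef_inj; apply/funext => j; rewrite coef0.
by apply: mpow_separated => N; have := Fs (N + j)%N j; rewrite addnK.
Qed.

Lemma filtX N v : filt 1 v -> filt N (v ^+ N).
Proof.
by move=> Fv; elim: N => [|N IH] //; rewrite exprS -add1n; exact: filtM.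
Qed.

(** The inverse is the geometric series, whose limit is taken coefficientwise in the complete ring
    [B]. *)
Lemma geometric_unit v : filt 1 v -> 1 - v \is a GRing.unit.
Proof.
move=> Fv; pose u i := \sum_(l < i) v ^+ l.
(* The shift by [j] makes up for the loss of [j] in [filt]: the j-th coefficient of [v ^+ (i + j)]
   lies in the i-th power of the maximal ideal. *)
have lim j : exists l, forall i, mpow B i (l - coef (u (i + j)%N) j).
  case: lsd => -[_ [_ compl]] _ _ _; apply: compl => i.
  rewrite -coefB /u addSn big_ord_recr /= addrAC subrr add0r.
  by have := filtX (i + j) Fv j; rewrite addnK.
have /choice[l Hl] := lim.
have [coefi coefK coefiK] := sps_bij sps.
pose L := coefi l.
have FL i : filt i (L - u i).
  move=> j; rewrite coefB /L coefiK; have [ji|ij] := leqP j i.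
    by have := Hl j (i - j)%N; rewrite subnK.
  by rewrite (eqP (ltnW ij)).
have geo1 i : (1 - v) * u i = 1 - v ^+ i.
  by rewrite -[1 - v]opprB mulNr -subrX1 opprB.
have geo2 i : u i * (1 - v) = 1 - v ^+ i.
  rewrite -geo1; apply/esym/commr_sum => l' _; apply/commrX/commr_sym/commrB => //.
    exact: commr1.
apply/unitrP; exists L; split; apply/eqP; rewrite -subr_eq0; apply/eqP;
    apply: filt_separated => N.
  rewrite -[L](subrK (u N)) mulrDl geo2 -addrA (addrAC 1) subrr add0r; apply: filtD.
    by have := filtM (FL N) (@filt0 (1 - v)); rewrite addn0.
  exact/filtN/filtX.
rewrite -[L](subrK (u N)) mulrDr geo1 -addrA (addrAC 1) subrr add0r; apply: filtD.
  exact: (filtM (@filt0 (1 - v)) (FL N)).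
exact/filtN/filtX.
Qed.

(** If the constant coefficient is a unit, dividing by it leaves [1 - v] with [v] in [filt 1], a
    unit by the geometric series. Conversely, [filt 1] is stable under right multiplication and does
    not contain 1. *)
Lemma maxideal_filt s : maxideal s <-> filt 1 s.
Proof.
split=> [ns|Fs].
  suff Is : maxideal (coef s 0).
    by case=> [|j] //; rewrite subn0; exact/mpow1.
  apply/negP => us; move/negP: ns; apply.
  pose b := coef s 0; pose v := 1 - g b^-1 * s.
  have Fv : filt 1 v.
    case=> [|j] //; rewrite /v coefB (sps_scale sps) mulVr //.
    by rewrite -(expr0 y) (sps_var sps) subrr; exact: mpow0.
  have -> : s = g b * (1 - v).
    by rewrite subKr mulrA -rmorphM mulrV // rmorph1 mul1r.
  by rewrite unitrMl ?geometric_unit // rmorph_unit.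
apply/negP => us; have := filtM Fs (@filt0 s^-1).
rewrite mulrV // => /(_ 0%N); rewrite -(expr0 y) (sps_var sps) /= => I1.
exact: (@maxideal1 B ((mpow1 locB _).1 I1)).
Qed.

Lemma local_series : local_ring S.
Proof.
by move=> a b /maxideal_filt Fa /maxideal_filt Fb; apply/maxideal_filt/filtD.
Qed.

Lemma mpow_const N b : mpow B N b -> mpow S N (g b).
Proof.
elim: N b => [|N IH] b //= [u Iu ->]; exists [seq (g w.1, g w.2) | w <- u].
  move=> _ /mapP[w /Iu[w1 w2] ->] /=; split; last exact: IH.
  apply/maxideal_filt => j; rewrite coef_const; case: eqP => [->|_].
    exact/mpow1.
  exact: mpow0.
by rewrite big_map rmorph_sum; apply: eq_bigr => i _; rewrite rmorphM.
Qed.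

(** The hypotheses describe [coef] for left multiplication by constants; the effect of a right
    factor [y ^+ N] is read off from truncations, by continuity and separatedness. *)
Lemma coef_shift t N j :
  coef (t * y ^+ N) j = if (j < N)%N then 0 else coef t (j - N).
Proof.
apply/eqP; rewrite -subr_eq0; apply/eqP; apply: mpow_separated => K.
have [M HM] := sps_continuous sps t (y ^+ N) (maxn K j.+1).
have := HM (trunc (maxn M j.+1) t) (y ^+ N) (trunc_near t (leq_maxl _ _)).
move=> /(_ (@near0 _ _) j (leq_maxr _ _)); rewrite coefB.
suff -> : coef (trunc (maxn M j.+1) t * y ^+ N) j =
    if (j < N)%N then 0 else coef t (j - N).
  move=> H; rewrite -opprB; apply: (mpowN locB).
  by apply: mpow_leq H => //; exact: leq_maxl.
rewrite mulr_suml coef_sum.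
under eq_bigr => i _ do rewrite -mulrA -exprD coef_term.
have [jN|Nj] := ltnP j N.
  by rewrite big1 // => i _; case: eqP => // ij; exfalso; lia.
have lt : (j - N < maxn M j.+1)%N by lia.
rewrite (bigD1 (Ordinal lt)) //= subnK // eqxx big1 ?addr0 // => i.
by rewrite -val_eqE /=; case: eqP => // ij; case: eqP => // ijN; exfalso; lia.
Qed.

(** For the inclusion of [filt N] in the N-th power, split off the terms of index below [N]: each is
    a product of elements of the powers [N - j] and [j], and the rest is a left multiple of
    [y ^+ N]. *)
Lemma mpow_filt N s : mpow S N s <-> filt N s.
Proof.
split.
  elim: N s => [|N IH] s //= [u Iu ->]; rewrite big_seq.
  apply: filt_sum => w /Iu[/maxideal_filt w1 /IH w2].
  by rewrite -add1n; exact: filtM.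
move=> Fs; have [coefi coefK coefiK] := sps_bij sps.
pose t := coefi (fun j => coef s (j + N)%N).
have -> : s = trunc N s + t * y ^+ N.
  apply: coef_inj; apply/funext => j; rewrite (sps_add sps) coef_trunc coef_shift.
  have [jN|Nj] := ltnP j N; first by rewrite addr0.
  by rewrite add0r coefiK subnK.
have Iy i : mpow S i (y ^+ i).
  elim: i => [|i IH] //; rewrite exprS -add1n; apply: (mpowM local_series) => //.
  apply/(mpow1 local_series)/maxideal_filt => j; rewrite -(expr1 y) (sps_var sps).
  by case: j => [|j] //; exact: mpow0.
apply: mpowD; last by apply: (mpow_mull local_series).
apply: mpow_sum => j _.
have := mpowM local_series (mpow_const (Fs j)) (Iy j).
by rewrite subnK // ltnW.
Qed.

End SkewPowerSeries.

(** * Digit systems *)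

Definition degree n (alpha : multi n) : nat := (\sum_(i < n) alpha i)%N.

Definition divides n (alpha beta : multi n) : Prop :=
  forall i, (alpha i <= beta i)%N.

Definition monomial_seq (R : unitRingType) n (xs : seq R) (alpha : multi n) : R :=
  \prod_(i < n) xs`_i ^+ alpha i.

(* The hypothesis of [dg_add] ensures that no carry reaches alpha. *)
Record digit_system (k : finFieldType) (R : unitRingType) (n : nat) (e : k -> R)
    (xs : seq R) (c : R -> multi n -> k) : Prop := {
  dg_local : local_ring R;
  dg_bij : bijective c;
  dg_add : forall r s alpha,
    (forall beta, divides beta alpha -> beta != alpha ->
       c r beta = 0 \/ c s beta = 0) ->
    c (r + s) alpha = c r alpha + c s alpha;
  dg_scale : forall d r alpha, c (e d * r) alpha = d * c r alpha;
  dg_monomial : forall alpha beta,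
    c (monomial_seq xs alpha) beta = (alpha == beta)%:R;
  dg_comm : forall d i, (i < n)%N -> e d * xs`_i = xs`_i * e d;
  dg_mult : {morph e : a b / a * b};
  dg_mpow : forall N r,
    mpow R N r <-> forall alpha, (degree alpha < N)%N -> c r alpha = 0 }.

Definition restrict n (alpha : multi n.+1) : multi n :=
  [ffun i => alpha (widen_ord (leqnSn n) i)].

Definition extend n (alpha : multi n) (j : nat) : multi n.+1 :=
  [ffun i : 'I_n.+1 => oapp alpha j (insub (val i))].

Lemma extend_widen n (alpha : multi n) j i :
  extend alpha j (widen_ord (leqnSn n) i) = alpha i.
Proof. by rewrite ffunE insubT //= => lt; congr (alpha _); apply: val_inj. Qed.

Lemma extend_max n (alpha : multi n) j : extend alpha j ord_max = j.
Proof. by rewrite ffunE insubF //= ltnn. Qed.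

Lemma extendK n (alpha : multi n) j : restrict (extend alpha j) = alpha.
Proof. by apply/ffunP => i; rewrite ffunE extend_widen. Qed.

Lemma widen_or_max n (i : 'I_n.+1) :
  i = ord_max \/ exists i', i = widen_ord (leqnSn n) i'.
Proof.
have [lt|ge] := ltnP i n; [right|left]; last first.
  by apply: val_inj => /=; have := ltn_ord i; lia.
by exists (Ordinal lt); apply: val_inj.
Qed.

Lemma restrictK n (alpha : multi n.+1) :
  extend (restrict alpha) (alpha ord_max) = alpha.
Proof.
apply/ffunP => i; case: (widen_or_max i) => [->|[i' ->]].
  by rewrite extend_max.
by rewrite extend_widen ffunE.
Qed.

Lemma extend_divides n (alpha beta : multi n) j :
  divides alpha beta -> divides (extend alpha j) (extend beta j).
Proof.
move=> ab i; case: (widen_or_max i) => [->|[i' ->]]; first by rewrite !extend_max.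
by rewrite !extend_widen.
Qed.

Lemma degree_restrict n (alpha : multi n.+1) :
  degree alpha = (degree (restrict alpha) + alpha ord_max)%N.
Proof.
rewrite /degree big_ord_recr; congr (_ + _)%N.
by apply: eq_bigr => i _; rewrite ffunE.
Qed.

Lemma degree_extend n (alpha : multi n) j :
  degree (extend alpha j) = (degree alpha + j)%N.
Proof. by rewrite degree_restrict extendK extend_max. Qed.

Lemma digit0 k R n e xs c : @digit_system k R n e xs c ->
  forall alpha, c 0 alpha = 0.
Proof.
move=> D alpha; have [N] := ubnP (degree alpha).
by move: alpha; apply/(dg_mpow D); exact: mpow0.
Qed.

(** * Adjoining a variable to a digit system *)

Section Step.
Variables (k : finFieldType) (B S : unitRingType) (n : nat).
Variables (e : k -> B) (xs : seq B) (c : B -> multi n -> k).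
Variables (sigma : {rmorphism B -> B}) (delta : {additive B -> B}).
Variables (g : {rmorphism B -> S}) (y : S) (coef : S -> nat -> B).
Hypothesis D : digit_system e xs c.
Hypothesis size_xs : size xs = n.
Hypothesis lsd : local_skew_derivation sigma delta.
Hypothesis sps : skew_power_series_ring sigma delta g y coef.
Hypothesis lin : forall d, sigma (e d) = e d /\ delta (e d) = 0.

(** Addition and left multiplication by constants act on each coefficient separately, so carries
    stay inside one coefficient and keep the exponent of [y]. Linearity of the skew derivation makes
    [y] commute with the constants [e d]. *)
Lemma digit_system_series :
  digit_system (g \o e) (rcons [seq g z | z <- xs] y)
    (fun s alpha => c (coef s (alpha ord_max)) (restrict alpha)).
Proof.
split.
- exact: local_series lsd sps.
- have [ci cK ciK] := dg_bij D; have [coefi coefK coefiK] := sps_bij sps.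
  exists (fun f => coefi (fun j => ci (fun alpha => f (extend alpha j)))).
    move=> s; apply: (coef_inj sps); rewrite coefiK; apply/funext => j.
    rewrite -[RHS]cK; congr (ci _); apply/funext => alpha.
    by rewrite extend_max extendK.
  move=> f; apply/funext => alpha; rewrite coefiK ciK.
  by rewrite restrictK.
- move=> r s alpha H; rewrite (sps_add sps); apply: (dg_add D) => beta le ne.
  have := H (extend beta (alpha ord_max)); rewrite extend_max extendK; apply.
    by rewrite -[X in divides _ X]restrictK; exact: extend_divides.
  by apply: contraNneq ne => E; rewrite -E extendK.
- by move=> d r alpha; rewrite (sps_scale sps) (dg_scale D).
- move=> alpha beta; rewrite /monomial_seq big_ord_recr /=.
  rewrite nth_rcons size_map size_xs ltnn eqxx.
  have -> : \prod_(i < n) (rcons [seq g z | z <- xs] y)`_i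
      ^+ alpha (widen_ord (leqnSn n) i) = g (monomial_seq xs (restrict alpha)).
    rewrite rmorph_prod; apply: eq_bigr => i _.
    rewrite nth_rcons size_map size_xs ltn_ord (nth_map 0) ?size_xs //.
    by rewrite rmorphXn ffunE.
  rewrite (coef_term sps); case: eqP => [E|E].
    rewrite (dg_monomial D); congr (nat_of_bool _)%:R; apply/eqP/eqP => [E'|->//].
    by rewrite -[alpha]restrictK E E' restrictK.
  by rewrite (digit0 D); case: eqP => // E'; case: E; rewrite E'.
- move=> d i; rewrite ltnS leq_eqVlt => /predU1P[->|lt] /=.
    rewrite nth_rcons size_map size_xs ltnn eqxx (sps_comm sps).
    by have [-> ->] := lin d; rewrite raddf0 addr0.
  rewrite nth_rcons size_map size_xs lt (nth_map 0) ?size_xs //.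
  by rewrite -!rmorphM (dg_comm D).
- by move=> a b /=; rewrite (dg_mult D) rmorphM.
- move=> N r; rewrite (mpow_filt lsd sps); split=> [Fr alpha lt|H j].
    apply: ((dg_mpow D _ _).1 (Fr _)); move: lt; rewrite degree_restrict.
    by lia.
  apply/(dg_mpow D) => alpha lt.
  have := H (extend alpha j); rewrite extend_max extendK degree_extend; apply.
  by lia.
Qed.

End Step.

(** The list [x0] holds the variables already present in the coefficient ring, none in type (A) and
    the uniformiser in type (B), so that one induction serves both types. *)
Lemma digit_system_iterated (k : finFieldType) (A S : unitRingType) n0
    (iota : k -> A) (x0 : seq A) (c0 : A -> multi n0 -> k)
    (f : {rmorphism A -> S}) (ys : seq S) :
  size x0 = n0 ->
  digit_system iota x0 c0 -> iterated f ys ->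
  exists n (c : S -> multi n -> k), (size [seq f a | a <- x0] + size ys)%N = n /\
    digit_system (f \o iota) ([seq f a | a <- x0] ++ ys) c.
Proof.
move=> sz D0 It; elim: It => {S f ys}.
  by exists n0, c0; rewrite map_id cats0 /= addn0.
move=> B S f ys sigma delta g y coef _ [n [c [szn D]]] lsd lin sps.
exists n.+1.
exists (fun s (alpha : multi n.+1) => c (coef s (alpha ord_max)) (restrict alpha)).
split; first by rewrite !size_map size_rcons size_map addnS -szn size_map.
have -> : [seq (g \o f) a | a <- x0] ++ rcons [seq g z | z <- ys] y =
    rcons [seq g z | z <- [seq f a | a <- x0] ++ ys] y.
  by rewrite map_cat -map_comp rcons_cat.
by apply: (digit_system_series D _ lsd sps) => [|d]; [rewrite size_cat|exact: lin].
Qed.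

Lemma digit_system_field (k : finFieldType) :
  @digit_system k k 0 id [::] (fun r _ => r).
Proof.
have unique (alpha beta : multi 0) : alpha = beta by apply/ffunP => -[].
have mx (a : k) : maxideal a <-> a = 0.
  by rewrite /maxideal /= unitfE negbK; split=> /eqP.
have loc : local_ring k by move=> a b /mx -> /mx ->; rewrite addr0; exact/mx.
split=> //.
- by exists (fun h => h 0) => // h; apply/funext => alpha; congr h.
- move=> alpha beta; rewrite /monomial_seq big_ord0.
  by rewrite (unique alpha beta) eqxx.
- move=> N r; split=> [Ir alpha N0|]; last first.
    case: N => [//|N] H; have -> : r = 0 by apply: (H 0); rewrite /degree big_ord0.
    exact: mpow0.
  by apply/mx/(mpow1 loc)/(mpow_leq loc _ Ir); case: N N0 {Ir}.
Qed.

(** * Teichmueller digits in a complete discrete valuation ring *)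

Section DVR.
Variables (k : finFieldType) (A : idomainType) (rho : {rmorphism A -> k}).
Variables (iota : k -> A) (x1 : A).
Hypothesis dvrA : discrete_valuation_ring A.
Hypothesis complA : complete_local_ring A.
Hypothesis unif : uniformiser x1.
Hypothesis resA : residue_map rho.
Hypothesis secA : multiplicative_section rho iota.

Let locA : local_ring A. Proof. by case: complA. Qed.

(** Both [iota 0] and [iota 1] are idempotent, hence 0 or 1 in a domain, and [rho] tells which. *)
Lemma section0 : iota 0 = 0.
Proof.
have [K M] := secA; have := M 0 0; rewrite mul0r => /eqP.
rewrite -[X in X == _]mulr1 -subr_eq0 -mulrBr mulf_eq0 => /orP[/eqP//|].
rewrite subr_eq0 => /eqP E; have := K 0; rewrite -E rmorph1 => /eqP.
by rewrite oner_eq0.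
Qed.

Lemma section1 : iota 1 = 1.
Proof.
have [K M] := secA; have := M 1 1; rewrite mul1r => /eqP.
rewrite -[X in X == _]mulr1 -subr_eq0 -mulrBr mulf_eq0 => /orP[/eqP E|].
  by have := K 1; rewrite E rmorph0 => /eqP; rewrite eq_sym oner_eq0.
by rewrite subr_eq0 => /eqP.
Qed.

Lemma uniformiser_neq0 : x1 != 0.
Proof.
have [a a0 Ia] := dvr_not_field dvrA; move: Ia; rewrite unif => -[c E].
by apply: contra_neq a0; rewrite E => ->; rewrite mulr0.
Qed.

Lemma residue_decomposition a : exists a', a = iota (rho a) + x1 * a'.
Proof.
have [K _] := secA.
have : maxideal (a - iota (rho a)) by apply: (resA.2 _).1; rewrite rmorphB K subrr.
rewrite unif => -[c E]; exists c.
by rewrite mulrC -E addrC subrK.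
Qed.

Definition tail a := xget 0 [set a' | a = iota (rho a) + x1 * a'].

Lemma tailE a : a = iota (rho a) + x1 * tail a.
Proof. exact: (xgetPex 0 (residue_decomposition a)). Qed.

Lemma rho_x1 : rho x1 = 0.
Proof. by apply/resA.2; rewrite unif; exists 1; rewrite mul1r. Qed.

Lemma residueE d b : rho (iota d + x1 * b) = d.
Proof. by rewrite rmorphD rmorphM rho_x1 mul0r addr0 secA.1. Qed.

Lemma tail_unique d b : tail (iota d + x1 * b) = b.
Proof.
have := tailE (iota d + x1 * b); rewrite residueE => /addrI.
by move/(mulfI uniformiser_neq0).
Qed.

(** These are the Teichmueller digits, with a = sum_i iota(digit i a) x1^i; each [tail] strips off
    the lowest one. *)
Definition digit i a := rho (iter i tail a).

Lemma digit_tail i a : digit i.+1 a = digit i (tail a).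
Proof. by rewrite /digit iterSr. Qed.

Lemma mpow_uniformiser N a : mpow A N a <-> exists b, a = x1 ^+ N * b.
Proof.
have Ix1 : maxideal x1 by rewrite unif; exists 1; rewrite mul1r.
split=> [|[b ->]].
  elim: N a => [|N IH] a; first by exists a; rewrite mul1r.
  move=> [u Iu ->]; rewrite big_seq.
  elim/big_ind: _ => [|_ _ [b ->] [b' ->]|[a1 a2] /Iu[/= I1 /IH[b ->]]].
  - by exists 0; rewrite mulr0.
  - by exists (b + b'); rewrite mulrDr.
  - by move: I1; rewrite unif => -[a' ->]; exists (a' * b); rewrite exprS; ring.
apply: mpow_mulr => //; elim: N => [|N IH] //; rewrite exprS -add1n.
by apply: mpowM => //; exact/mpow1.
Qed.

Lemma mpow_digit N a : mpow A N a <-> forall i, (i < N)%N -> digit i a = 0.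
Proof.
rewrite mpow_uniformiser; elim: N a => [|N IH] a.
  by split=> // _; exists a; rewrite mul1r.
split=> [[b ->] i|H].
  have E : x1 ^+ N.+1 * b = iota 0 + x1 * (x1 ^+ N * b).
    by rewrite section0 add0r exprS mulrA.
  case: i => [_|i lt]; first by rewrite E /digit /= residueE.
  by rewrite digit_tail E tail_unique; apply: ((IH _).1 _ i lt); exists b.
have [b E] : exists b, tail a = x1 ^+ N * b.
  by apply/IH => i lt; rewrite -digit_tail; exact: H.
exists b; rewrite [a]tailE E exprS -mulrA.
by have := H 0%N isT; rewrite /digit /= => ->; rewrite section0 add0r.
Qed.

(** The section [iota] need not be additive, but it respects a sum with a zero summand. Below
    position [i] there is thus no carry, and [tail] is additive at each step. *)
Lemma digitD i a b :
  (forall j, (j < i)%N -> digit j a = 0 \/ digit j b = 0) ->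
  digit i (a + b) = digit i a + digit i b.
Proof.
elim: i a b => [|i IH] a b H; first by rewrite /digit /= rmorphD.
rewrite !digit_tail -IH; last by move=> j lt; rewrite -!digit_tail; exact: H.
congr digit; have E : iota (rho a) + iota (rho b) = iota (rho a + rho b).
  case: (H 0%N isT); rewrite /digit /= => ->; rewrite section0.
    by rewrite !add0r.
  by rewrite !addr0.
rewrite {1}[a]tailE {1}[b]tailE addrACA E -mulrDr.
by rewrite tail_unique.
Qed.

Lemma digitM i d a : digit i (iota d * a) = d * digit i a.
Proof.
elim: i a => [|i IH] a; first by rewrite /digit /= rmorphM secA.1.
rewrite !digit_tail -IH; congr digit.
by rewrite {1}[a]tailE mulrDr -secA.2 mulrCA tail_unique.
Qed.

Lemma digitX i m : digit i (x1 ^+ m) = (m == i)%:R.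
Proof.
have x10 a : x1 * a = iota 0 + x1 * a by rewrite section0 add0r.
elim: i m => [|i IH] [|m].
- by rewrite /digit /= rmorph1.
- by rewrite /digit /= exprS x10 residueE.
- rewrite digit_tail expr0 -[1]addr0 -{1}section1 -(mulr0 x1) tail_unique.
  by apply: ((mpow_digit i.+1 0).1 (mpow0 _ _)).
- by rewrite digit_tail exprS x10 tail_unique IH.
Qed.

Lemma digit_inj a b : (forall i, digit i a = digit i b) -> a = b.
Proof.
move=> E; apply/eqP; rewrite -subr_eq0; apply/eqP; apply: complA.2.1 => N.
apply/mpow_uniformiser; elim: N a b E => [|N IH] a b E.
  by exists (a - b); rewrite mul1r.
have [i|t Et] := IH (tail a) (tail b); first by rewrite -!digit_tail.
exists t; rewrite exprS -mulrA -Et mulrBr {1}[a]tailE {1}[b]tailE.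
by have := E 0%N; rewrite /digit /= => ->; rewrite [iota _ + _]addrC addrKA.
Qed.

Lemma digit_surj (h : nat -> k) : exists a, forall i, digit i a = h i.
Proof.
pose u (h : nat -> k) N := \sum_(i < N) iota (h i) * x1 ^+ i.
have uS h' N : u h' N.+1 = iota (h' 0%N) + x1 * u (h' \o S) N.
  rewrite /u big_ord_recl expr0 mulr1 mulr_sumr; congr (_ + _).
  by apply: eq_bigr => i _; rewrite exprS mulrCA.
(* The partial sums converge by completeness. The limit differs from the sum through index [i] by a
   multiple of x1^(i+1), which has no digit at [i] or below. *)
have [N|l Hl] := complA.2.2 (u h).
  rewrite /u big_ord_recr /= addrAC subrr add0r.
  by apply/mpow_uniformiser; exists (iota (h N)); rewrite mulrC.
exists l => i; have -> : h i = digit i (u h i.+1).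
  elim: i h {l Hl} => [|i IH] h'; rewrite uS; first by rewrite /digit /= residueE.
  by rewrite digit_tail tail_unique -IH.
have Hi := (mpow_digit _ _).1 (Hl i.+1).
rewrite -{1}[l](subrK (u h i.+1)) digitD => [|j lt]; last by left; exact/Hi/ltnW.
by rewrite Hi // add0r.
Qed.

Lemma digit_system_dvr :
  digit_system iota [:: x1] (fun a (alpha : multi 1) => digit (alpha ord0) a).
Proof.
have deg1 (alpha : multi 1) : degree alpha = alpha ord0 by rewrite /degree big_ord1.
pose single i : multi 1 := [ffun=> i].
have singleK (alpha : multi 1) : single (alpha ord0) = alpha.
  by apply/ffunP => i; rewrite ffunE (ord1 i).
split=> //.
- have /choice[inv invK] := digit_surj.
  exists (fun h => inv (fun i => h (single i))).
    by move=> a; apply: digit_inj => i; rewrite invK ffunE.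
  by move=> h; apply/funext => alpha; rewrite invK singleK.
- move=> r s alpha H; apply: digitD => j lt.
  have := H (single j); rewrite ffunE; apply.
    by move=> i; rewrite ffunE (ord1 i) ltnW.
  by apply: contraTneq lt => <-; rewrite ffunE ltnn.
- by move=> d r alpha; exact: digitM.
- move=> alpha beta; rewrite /monomial_seq big_ord1 /= digitX.
  congr (nat_of_bool _)%:R; apply/eqP/eqP => [E|->//].
  by rewrite -(singleK alpha) E singleK.
- by move=> d i _; rewrite mulrC.
- exact: secA.2.
- move=> N r; rewrite mpow_digit; split=> H.
    by move=> alpha; rewrite deg1; exact: H.
  by move=> i lt; have := H (single i); rewrite deg1 ffunE; exact.
Qed.

End DVR.

(** * Coefficients and supports *)

Lemma digit_system_iterated_series (p : nat) (k : finFieldType)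
    (R : unitRingType) (e : k -> R) (xs : seq R) :
  iterated_local_skew_power_series_ring p e xs ->
  exists c : R -> multi (size xs) -> k, digit_system e xs c.
Proof.
case=> {R e xs}.
  move=> R f xs _ It.
  have [n [c [/= szn D]]] := digit_system_iterated
    (erefl : size [::] = 0%N) (digit_system_field k) It.
  by rewrite add0n in szn; subst n; exists c.
move=> A rho iota x1 R f ys _ _ dvrA complA unif resA secA It.
have D0 := digit_system_dvr dvrA complA unif resA secA.
have [n [c [/= szn D]]] :=
  digit_system_iterated (erefl : size [:: x1] = 1%N) D0 It.
by rewrite add1n in szn; subst n; exists c.
Qed.

Section Coefficients.
Variables (k : finFieldType) (R : unitRingType) (n : nat) (e : k -> R).
Variables (x : n.-tuple R) (c : R -> multi n -> k).
Hypothesis D : digit_system e x c.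
Implicit Types (r s : R) (alpha beta : multi n) (d : k).

Lemma monomialE alpha : monomial x alpha = monomial_seq x alpha.
Proof. by apply: eq_bigr => i _; rewrite (tnth_nth 0). Qed.

Lemma digits_inj r s : (forall alpha, c r alpha = c s alpha) -> r = s.
Proof. by move=> E; apply: (bij_inj (dg_bij D)); apply/funext. Qed.

Lemma digits_realize (h : multi n -> k) : exists r, c r = h.
Proof. by have [ci _ ciK] := dg_bij D; exists (ci h). Qed.

Lemma digits_add_disjoint r s : (forall beta, c r beta = 0 \/ c s beta = 0) ->
  forall alpha, c (r + s) alpha = c r alpha + c s alpha.
Proof. by move=> H alpha; apply: (dg_add D) => beta _ _. Qed.

Lemma dg_e0 r : e 0 * r = 0.
Proof.
by apply: digits_inj => alpha; rewrite (dg_scale D) mul0r (digit0 D).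
Qed.

Lemma digit_monomial alpha beta : c (monomial x alpha) beta = (alpha == beta)%:R.
Proof. by rewrite monomialE (dg_monomial D). Qed.

Lemma digit_term d alpha beta :
  c (e d * monomial x alpha) beta = if alpha == beta then d else 0.
Proof.
by rewrite (dg_scale D) digit_monomial; case: eqP; rewrite ?mulr1 ?mulr0.
Qed.

Lemma dg_comm_monomial d alpha : e d * monomial x alpha = monomial x alpha * e d.
Proof.
apply: (big_ind (fun m => e d * m = m * e d)).
- by rewrite mulr1 mul1r.
- by move=> a b Ha Hb; rewrite mulrA Ha -mulrA Hb mulrA.
- move=> i _; apply: commrX; rewrite (tnth_nth 0); exact: (dg_comm D).
Qed.

Definition partial_sum (w : seq (multi n)) (h : multi n -> k) : R :=
  \sum_(alpha <- w) e (h alpha) * monomial x alpha.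

Lemma digit_partial_sum w h beta : uniq w ->
  c (partial_sum w h) beta = if beta \in w then h beta else 0.
Proof.
rewrite /partial_sum; elim: w beta => [|a w IH] beta /=.
  by rewrite big_nil (digit0 D).
move=> /andP[aw uw]; rewrite big_cons digits_add_disjoint; last first.
  move=> gamma; rewrite IH // digit_term; case: eqP => [<-|_]; last by left.
  by right; rewrite (negbTE aw).
rewrite IH // digit_term inE eq_sym; case: eqP => [->|_]; last by rewrite add0r.
by rewrite (negbTE aw) addr0.
Qed.

(** Subtraction may borrow, so it is not carried out digitwise. Instead the element [u] with the
    remaining digits is added to the partial sum; the supports are disjoint and no carry arises. *)
Lemma partial_sum_remainder w h r : uniq w -> {in w, h =1 c r} ->
  forall alpha, c (r - partial_sum w h) alpha = if alpha \in w then 0 else c r alpha.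
Proof.
move=> uw hr; have [u cu] := digits_realize (fun a => if a \in w then 0 else c r a).
suff E : r = partial_sum w h + u by move=> a; rewrite {1}E addrAC subrr add0r cu.
apply: digits_inj => alpha; rewrite digits_add_disjoint => [|beta]; last first.
  by rewrite digit_partial_sum // cu; case: ifP; [right|left].
by rewrite digit_partial_sum // cu; case: ifP => [/hr->|]; rewrite ?addr0 ?add0r.
Qed.

(** The list is a box with all entries below [N]; it only has to contain every exponent of degree
    below [N]. *)
Definition low_degree N : seq (multi n) :=
  undup (codom (fun h : {ffun 'I_n -> 'I_N} => [ffun i => val (h i)] : multi n)).

Lemma low_degreeP N alpha : (degree alpha < N)%N -> alpha \in low_degree N.
Proof.
move=> lt; have ltN i : (alpha i < N)%N.
  by apply: leq_ltn_trans lt; rewrite /degree (bigD1 i) //= leq_addr.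
rewrite mem_undup; apply/codomP; exists [ffun i => Ordinal (ltN i)].
by apply/ffunP => i; rewrite !ffunE.
Qed.

Lemma mpow_partial_sum N w r : uniq w -> {subset low_degree N <= w} ->
  mpow R N (r - partial_sum w (c r)).
Proof.
move=> uw sw; apply/(dg_mpow D) => alpha lt.
by rewrite partial_sum_remainder // sw // low_degreeP.
Qed.

Lemma digit_congr N r s alpha :
  mpow R N (r - s) -> (degree alpha < N)%N -> c r alpha = c s alpha.
Proof.
move=> /(dg_mpow D) H lt; rewrite -(subrK s r) (dg_add D) ?H ?add0r //.
move=> beta le _; left; apply: H; apply: leq_ltn_trans lt.
by apply: leq_sum => i _; exact: le.
Qed.

(** Modulo a high power of the maximal ideal, [r] is a finite sum of distinct terms, whose digits
    are known; this forces [h]. In the other direction, the exponents in [low_degree N] suffice for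
    precision [N]. *)
Lemma expansionP r h : expansion e x r h <-> h = c r.
Proof.
split=> [Eh|-> N]; last first.
  by exists (low_degree N) => w uw sw; exact: mpow_partial_sum.
apply/funext => alpha; have [w0 Hw] := Eh (degree alpha).+1.
have /Hw H := undup_uniq (alpha :: w0).
rewrite (digit_congr (H _) (ltnSn _)).
  by rewrite digit_partial_sum ?undup_uniq // mem_undup mem_head.
by move=> beta bw; rewrite mem_undup inE bw orbT.
Qed.

Lemma coefficientE r alpha : coefficient e x r alpha = c r alpha.
Proof.
rewrite /coefficient; case: xgetP => [_ -> [h /expansionP -> ->] //|H].
by case: (H (c r alpha)); exists (c r) => //; exact/expansionP.
Qed.

Lemma suppE r alpha : supp e x r alpha <-> c r alpha != 0.
Proof. by rewrite /supp /= coefficientE. Qed.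

End Coefficients.

(** * Dickson's lemma and additive orders *)

(** The subsequence passes through indices at which [u] is minimal among all later values. *)
Lemma nat_monotone_subsequence (u : nat -> nat) : exists phi : nat -> nat,
  {homo phi : i j / (i < j)%N} /\ {homo u \o phi : i j / (i <= j)%N}.
Proof.
have next m : exists i, (m <= i)%N /\ forall j, (m <= j)%N -> (u i <= u j)%N.
  pose P v := `[< exists2 i, (m <= i)%N & u i = v >].
  have exP : exists v, P v by exists (u m); apply/asboolP; exists m.
  case: (ex_minnP exP) => v /asboolP[i mi <-] min; exists i; split=> // j mj.
  by apply: min; apply/asboolP; exists j.
have [F HF] := choice next.
pose phi i := iter i (fun m => F m.+1) (F 0%N).
have phi_min i j : (phi i <= j)%N -> (u (phi i) <= u j)%N.
  case: i => [|i] le; first exact: (HF 0%N).2.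
  by apply: (HF _).2; apply: leq_trans le; exact: (HF _).1.
have phi_lt : {homo phi : i j / (i < j)%N}.
  by apply: homo_ltn => [|i]; [exact: ltn_trans|exact: (HF _).1].
exists phi; split=> // i j ij; apply: phi_min.
by move: ij; rewrite leq_eqVlt => /predU1P[->//|/phi_lt/ltnW].
Qed.

(** The sequence is thinned out one coordinate at a time until every coordinate is monotone; then
    its first two terms do. *)
Lemma dickson n (u : nat -> multi n) : exists i j, (i < j)%N /\ divides (u i) (u j).
Proof.
suff /(_ n)[phi [phi_lt phi_mono]] : forall m, exists phi : nat -> nat,
    {homo phi : i j / (i < j)%N} /\
    forall a : 'I_n, (a < m)%N -> {homo (fun i => u (phi i) a) : i j / (i <= j)%N}.
  by exists (phi 0%N), (phi 1%N); split=> [|a]; [exact: phi_lt|exact: phi_mono].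
elim=> [|m [phi [phi_lt phi_mono]]]; first by exists id; split.
have [lt|ge] := ltnP m n; last first.
  by exists phi; split=> // a _; apply: phi_mono; apply: leq_trans ge.
have [psi [psi_lt psi_mono]] :=
  nat_monotone_subsequence (fun i => u (phi i) (Ordinal lt)).
exists (phi \o psi); split=> [i j /psi_lt/phi_lt //|a].
rewrite ltnS leq_eqVlt => /predU1P[E|am] i j ij.
  by have -> : a = Ordinal lt; [exact: val_inj|exact: psi_mono].
apply: (phi_mono _ am); move: ij; rewrite leq_eqVlt => /predU1P[->//|/psi_lt].
exact: ltnW.
Qed.

Section AdditiveOrder.
Variables (n : nat) (le : rel (multi n)).
Hypothesis ato : additive_total_order le.
Implicit Types alpha beta gamma : multi n.

Lemma strictE alpha beta : strict le alpha beta = ~~ le beta alpha.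
Proof.
rewrite /strict; apply/andP/idP => [[ne ab]|nba].
  by apply: contra ne => ba; apply/eqP/(ato_anti ato)/andP.
have := ato_total ato alpha beta; rewrite (negbTE nba) orbF => ab; split=> //.
by apply: contraNneq nba => ->; exact: ato_refl ato _.
Qed.

Lemma strict_le_trans alpha beta gamma :
  strict le alpha beta -> le beta gamma -> strict le alpha gamma.
Proof.
by rewrite !strictE => nba bg; apply: contra nba; exact: (ato_trans ato).
Qed.

Lemma le_strict_trans alpha beta gamma :
  le alpha beta -> strict le beta gamma -> strict le alpha gamma.
Proof.
rewrite !strictE => ab; apply: contra => ga; exact: (ato_trans ato) ga ab.
Qed.

Lemma le_addr alpha beta : le alpha (alpha + beta).
Proof.
have [->|b0] := eqVneq beta 0; first by rewrite addr0; exact: ato_refl ato _.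
have := ato_add ato alpha (ato_gt0 ato b0); rewrite add0r addrC.
by case/andP.
Qed.

Lemma le_divides alpha beta : divides alpha beta -> le alpha beta.
Proof.
move=> ab; have -> : beta = alpha + [ffun i => (beta i - alpha i)%N].
  by apply/ffunP => i; rewrite !ffunE; exact/esym/subnKC.
exact: le_addr.
Qed.

Lemma le_add2 alpha beta gamma : le alpha beta -> le (alpha + gamma) (beta + gamma).
Proof.
have [->|ne] := eqVneq alpha beta; first by move=> _; exact: ato_refl ato _.
by move=> ab; have /andP[] : strict le (alpha + gamma) (beta + gamma);
   first by apply: (ato_add ato); apply/andP.
Qed.

(** Without a minimum, choice yields an infinite strictly descending sequence. By Dickson's lemma
    some term divides a later one, and divisibility implies [le]. *)
Lemma order_min (P : set (multi n)) alpha0 : P alpha0 ->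
  exists2 alpha, P alpha & forall beta, P beta -> le alpha beta.
Proof.
move=> P0; apply: contrapT => nomin.
have next alpha : exists beta, P alpha -> P beta /\ strict le beta alpha.
  have [Pa|nPa] := pselect (P alpha); last by exists alpha.
  apply: contrapT => H; apply: nomin; exists alpha => // beta Pb.
  by apply/negPn/negP => nab; apply: H; exists beta => _; rewrite strictE.
have [F HF] := choice next.
pose u i := iter i F alpha0.
have Pu i : P (u i) by elim: i => //= i /HF[].
have desc : {homo u : i j / (i < j)%N >-> strict le j i}.
  apply: homo_ltn => [b a d|i]; last exact: (HF _ (Pu i)).2.
  by move=> ab bd; apply: le_strict_trans ab; case/andP: bd.
have [i [j [/desc ij /le_divides]]] := dickson u.
by move: ij; rewrite strictE => /negbTE ->.
Qed.

Lemma order_wf : well_founded (fun alpha beta => strict le alpha beta).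
Proof.
move=> alpha0; apply: contrapT => nacc.
have [alpha na min] := @order_min [set a | ~ Acc (fun a b => strict le a b) a] _ nacc.
apply: na; split=> beta lt; apply: contrapT => /min.
by move: lt; rewrite strictE => /negbTE ->.
Qed.

End AdditiveOrder.

(** * Elements supported in an up-closed set *)

Lemma upclosure1P n (m alpha : multi n) : upclosure [set m] alpha <-> divides m alpha.
Proof.
split=> [[_ -> [gamma ->]] i|le]; first by rewrite ffunE leq_addr.
exists m => //; exists [ffun i => (alpha i - m i)%N].
by apply/ffunP => i; rewrite !ffunE; exact/esym/subnKC.
Qed.

Lemma nth_regionsP n (ms : seq (multi n)) (U : set (multi n)) i alpha :
  (i < size ms)%N ->
  nth set0 (regions U ms) i alpha <->
  [/\ ~ U alpha, divides ms`_i alpha &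
      forall j, (j < i)%N -> ~ divides ms`_j alpha].
Proof.
elim: ms U i => [//|m ms IH] U [_|i] /=.
  by split=> [[/upclosure1P]|[nU /upclosure1P]].
rewrite ltnS => /(IH (U `|` (upclosure [set m] `\` U))) ->.
split=> [[nU di nd]|[nU di nd]].
  have nU' : ~ U alpha by move=> Ua; apply: nU; left.
  split=> // -[_ /upclosure1P dm|j]; last by rewrite ltnS => /nd.
  by apply: nU; right.
split=> // [[//|[/upclosure1P dm _]]|j lt]; last exact: (nd j.+1).
exact: (nd 0%N).
Qed.

Section Supported.
Variables (k : finFieldType) (R : unitRingType) (n : nat) (e : k -> R).
Variables (x : n.-tuple R) (c : R -> multi n -> k) (le : rel (multi n)).
Hypothesis D : digit_system e x c.
Hypothesis mo : monomial_order e x le.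
Implicit Types (r s u : R) (alpha beta gamma : multi n) (U : set (multi n)).

Let ato : additive_total_order le. Proof. by case: mo. Qed.

(** Used for the final segments [le alpha] and [strict le alpha] and for preimages of such sets
    under translation. Carries move to multiples of an exponent and so never leave an up-set. *)
Definition upset U := forall alpha beta, U alpha -> le alpha beta -> U beta.

Definition supported U r := forall alpha, c r alpha != 0 -> U alpha.

Lemma supported_out U r alpha : supported U r -> ~ U alpha -> c r alpha = 0.
Proof. by move=> Sr nU; apply/eqP; apply: contra_notT nU; exact: Sr. Qed.

Lemma upset_le alpha : upset (le alpha).
Proof. by move=> b d ab bd; exact: ato_trans ato _ _ _ ab bd. Qed.

Lemma upset_strict alpha : upset (strict le alpha).
Proof. by move=> b d; exact: strict_le_trans. Qed.

Lemma upset_divides U alpha beta : upset U -> divides beta alpha -> ~ U alpha ->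
  ~ U beta.
Proof. by move=> upU d nU Ub; apply/nU/(upU _ _ Ub)/le_divides. Qed.

Lemma supported_add_agree U s u alpha :
  upset U -> supported U u -> ~ U alpha -> c (s + u) alpha = c s alpha.
Proof.
move=> upU Su nU; rewrite (dg_add D) ?(supported_out Su nU) ?addr0 // => beta d _.
by right; apply: supported_out Su _; exact: upset_divides d nU.
Qed.

(** Induction along the order: for [alpha] outside [U], the digits of [r - s] at proper divisors of
    [alpha] vanish, so no carry disturbs the comparison of s + (r - s) with [s]. Closure under sums
    and negation is then obtained by comparison with 0. *)
Lemma supported_agree U r s : upset U ->
  (forall alpha, ~ U alpha -> c r alpha = c s alpha) -> supported U (r - s).
Proof.
move=> upU E alpha ne; apply: contrapT => nU; move/eqP: ne; apply.
elim/(well_founded_ind (order_wf ato)): alpha nU => alpha IH nU.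
have : c (s + (r - s)) alpha = c s alpha by rewrite addrC subrK E.
rewrite (dg_add D) => [/eqP|beta d ne]; first by rewrite addrC -subr_eq0 addrK => /eqP.
right; apply: IH; last exact: upset_divides d nU.
by rewrite /strict ne le_divides.
Qed.

Lemma supported0 U : supported U 0.
Proof. by move=> alpha; rewrite (digit0 D) eqxx. Qed.

Lemma supportedD U r s : upset U ->
  supported U r -> supported U s -> supported U (r + s).
Proof.
move=> upU Sr Ss; rewrite -[r + s]subr0; apply: supported_agree => // alpha nU.
by rewrite (supported_add_agree _ upU Ss nU) (digit0 D); exact: supported_out Sr nU.
Qed.

Lemma supportedN U r : upset U -> supported U r -> supported U (- r).
Proof.
move=> upU Sr; rewrite -sub0r; apply: supported_agree => // alpha nU.
by rewrite (digit0 D) (supported_out Sr nU).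
Qed.

Lemma supported_sum U (T : Type) (w : seq T) (P : pred T) (F : T -> R) :
  upset U ->
  (forall i, P i -> supported U (F i)) -> supported U (\sum_(i <- w | P i) F i).
Proof.
move=> upU SF; elim/big_ind: _ => //; [exact: supported0|].
by move=> r s; exact: supportedD.
Qed.

Lemma supported_scale U d r : supported U r -> supported U (e d * r).
Proof.
move=> Sr alpha; rewrite (dg_scale D) mulf_eq0 negb_or => /andP[_].
exact: Sr.
Qed.

Lemma supported_sub U U' r : U `<=` U' -> supported U r -> supported U' r.
Proof. by move=> sub Sr alpha /Sr/sub. Qed.

Lemma supported_closed U r :
  (forall N, exists2 s, supported U s & mpow R N (r - s)) -> supported U r.
Proof.
move=> H alpha; have [s Ss near] := H (degree alpha).+1.
by rewrite (digit_congr D near) //; exact: Ss.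
Qed.

Lemma digit_leadD alpha r s : supported (le alpha) r ->
  c (r + s) alpha = c r alpha + c s alpha.
Proof.
move=> Sr; apply: (dg_add D) => beta d ne; left.
apply: (supported_out Sr) => ab; move/eqP: ne; apply.
by apply: (ato_anti ato); rewrite ab le_divides.
Qed.

Lemma digit_leadN alpha r : supported (le alpha) r -> c (- r) alpha = - c r alpha.
Proof.
move=> Sr; have := digit_leadD (- r) Sr.
by rewrite subrr (digit0 D) => /esym/eqP; rewrite addrC addr_eq0 => /eqP.
Qed.

Lemma lead_cancel alpha r s : supported (le alpha) r -> supported (le alpha) s ->
  c s alpha != 0 -> exists d, supported (strict le alpha) (r - e d * s).
Proof.
move=> Sr Ss ne; exists (c r alpha / c s alpha).
have St := @supported_scale _ (c r alpha / c s alpha) _ Ss.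
have SN := supportedN (@upset_le alpha) St.
move=> beta; rewrite /strict; case: (eqVneq alpha beta) => [<-|_] /=; last first.
  exact: (supportedD (@upset_le alpha) Sr SN).
rewrite (digit_leadD _ Sr) digit_leadN // (dg_scale D) divfK //.
by rewrite subrr eqxx.
Qed.

Lemma LMP r : r != 0 -> c r (LM e x le r) != 0 /\ supported (le (LM e x le r)) r.
Proof.
move=> r0; rewrite /LM; case: xgetP => [m _ [Hm min]|none].
  by split=> [|alpha ne]; [exact/(suppE D)|exact/min/(suppE D)].
have [alpha Ha] : exists alpha, c r alpha != 0.
  apply: contrapT => H; move/eqP: r0; apply; apply: (digits_inj D) => alpha.
  by rewrite (digit0 D); apply/eqP; apply: contra_notT H => ne; exists alpha.
have [m Hm min] := @order_min _ _ ato [set a | c r a != 0] _ Ha.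
by case: (none m); split=> [|beta /(suppE D)]; [exact/(suppE D)|exact: min].
Qed.

Lemma monomialM_lead alpha beta :
  c (monomial x alpha * monomial x beta) (alpha + beta) != 0 /\
  supported (le (alpha + beta)) (monomial x alpha * monomial x beta).
Proof.
rewrite -(mo.2 alpha beta); apply: LMP; apply/eqP => E.
have m1 : monomial x 0 = 1.
  by rewrite /monomial big1 // => i _; rewrite ffunE.
(* Were the product 0, its [LM] would be the default value 0. This contradicts the monomial order
   unless both exponents are 0, and in that case the product is 1. *)
have [z|ne] := eqVneq (alpha + beta) 0.
  have [a0 b0] : alpha = 0 /\ beta = 0.
    split; apply/ffunP => i; move/ffunP/(_ i): z; rewrite !ffunE => /eqP;
      by rewrite -[_ + _]/(addn _ _) addn_eq0 => /andP[/eqP a0 /eqP b0].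
  by move/eqP: E; rewrite a0 b0 m1 mulr1 oner_eq0.
move/eqP: ne; apply; rewrite -mo.2 E /LM; case: xgetP => // m _ [/(suppE D)].
by rewrite (digit0 D) eqxx.
Qed.

(** Both factors are approximated by finite partial sums. The scalars commute with monomials, so
    only products of two monomials remain, and the monomial order prescribes where these begin. *)
Lemma supportedM U r s : upset U ->
  (forall alpha beta, c r alpha != 0 -> c s beta != 0 -> U (alpha + beta)) ->
  supported U (r * s).
Proof.
move=> upU HU; apply: supported_closed => N.
pose w := low_degree n N; have uw : uniq w := undup_uniq _.
have near t := mpow_partial_sum D t uw (fun=> id).
exists (partial_sum e x w (c r) * partial_sum e x w (c s)); last first.
  have loc := dg_local D.
  set r' := partial_sum _ _ _ (c r); set s' := partial_sum _ _ _ (c s).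
  have -> : r * s - r' * s' = (r - r') * s + r' * (s - s').
    by rewrite mulrBl mulrBr addrA subrK.
  by apply: mpowD; [exact: mpow_mulr|exact: mpow_mull].
rewrite mulr_suml; apply: supported_sum => // alpha _.
rewrite mulr_sumr; apply: supported_sum => // beta _.
have -> : e (c r alpha) * monomial x alpha * (e (c s beta) * monomial x beta) =
    e (c r alpha) * (e (c s beta) * (monomial x alpha * monomial x beta)).
  by rewrite -mulrA (mulrA (monomial _ _)) -(dg_comm_monomial D) !mulrA.
have [->|ne] := eqVneq (c r alpha) 0; first by rewrite (dg_e0 D); exact: supported0.
have [->|ne'] := eqVneq (c s beta) 0.
  by rewrite (dg_e0 D) mulr0; exact: supported0.
do 2!apply: supported_scale; apply: supported_sub (monomialM_lead _ _).2 => gamma.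
exact/upU/HU.
Qed.

(** Separate the leading digit of [r] from the rest [t]: the leading term is governed by
    [monomialM_lead], and the product with [t] lives strictly after [alpha + LM(r)]. *)
Lemma monomial_mul_lead alpha r : r != 0 ->
  c (monomial x alpha * r) (alpha + LM e x le r) != 0 /\
  supported (le (alpha + LM e x le r)) (monomial x alpha * r).
Proof.
move=> /LMP; set m := LM _ _ _ r => -[rm Sr].
have [mm Sm] := monomialM_lead alpha m.
have [t ct] := digits_realize D (fun b => if b == m then 0 else c r b).
have rE : r = e (c r m) * monomial x m + t.
  apply: (digits_inj D) => b; rewrite (digits_add_disjoint D) => [|b'].
    by rewrite (digit_term D) ct eq_sym; case: eqP => [->|]; rewrite ?addr0 ?add0r.
  by rewrite (digit_term D) ct eq_sym; case: eqP => _; [right|left].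
have E : monomial x alpha * r =
    e (c r m) * (monomial x alpha * monomial x m) + monomial x alpha * t.
  by rewrite {1}rE mulrDr mulrA -(dg_comm_monomial D) -mulrA.
have St : supported (strict le (alpha + m)) (monomial x alpha * t).
  apply: supportedM => [|a b]; first exact: upset_strict.
  rewrite (digit_monomial D) ct; case: (alpha =P a) => [<- _|_] /=; last by rewrite eqxx.
  case: (eqVneq b m) => [_|ne rb]; first by rewrite eqxx.
  have /(ato_add ato alpha) : strict le m b by rewrite /strict eq_sym ne Sr.
  by rewrite !(addrC alpha).
have irr : ~ strict le (alpha + m) (alpha + m) by rewrite /strict eqxx.
split; rewrite E.
  rewrite (supported_add_agree _ (@upset_strict _) St irr) (dg_scale D).
  by rewrite mulf_neq0.
apply: supportedD; [exact: upset_le|exact: supported_scale|].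
by apply: supported_sub St => b /andP[].
Qed.

End Supported.

(** * Right division *)

Lemma multi_addIr n (m : multi n) : injective (+%R^~ m).
Proof.
by move=> a b /ffunP E; apply/ffunP => i; move: (E i); rewrite !ffunE => /addIn.
Qed.

Section Division.
Variables (k : finFieldType) (R : unitRingType) (n : nat) (e : k -> R).
Variables (x : n.-tuple R) (c : R -> multi n -> k) (le : rel (multi n)).
Hypothesis D : digit_system e x c.
Hypothesis mo : monomial_order e x le.
Variables (s : nat) (G : s.-tuple R).
Hypothesis G_neq0 : forall i, tnth G i != 0.
Implicit Types (h : multi n -> k) (alpha beta : multi n) (i j : 'I_s).

Let ato : additive_total_order le. Proof. by case: mo. Qed.

Notation mu i := (LM e x le (tnth G i)).
Notation Dlt i := (Delta e x le G i).
Notation Dbar := (Delta_bar e x le G).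

Lemma DeltaP i alpha :
  Dlt i alpha <-> divides (mu i) alpha /\
    forall j, (j < i)%N -> ~ divides (mu j) alpha.
Proof.
have nthE j : [seq LM e x le g | g <- G]`_j = mu j.
  by rewrite (nth_map 0) ?size_tuple // (tnth_nth 0).
rewrite /Delta nth_regionsP ?size_map ?size_tuple // nthE.
split=> [[_ di nd]|[di nd]]; split=> // j lt; first by rewrite -nthE; exact: nd.
by rewrite (nthE (Ordinal (ltn_trans lt (ltn_ord i)))); exact: nd.
Qed.

Lemma Delta_inj i j alpha : Dlt i alpha -> Dlt j alpha -> i = j.
Proof.
move=> /DeltaP[di ni] /DeltaP[dj nj]; apply: val_inj.
by case: (ltngtP i j) => // [/nj|/ni].
Qed.

Lemma Delta_barP alpha : Dbar alpha <-> forall i, ~ divides (mu i) alpha.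
Proof.
split=> [nD i di|nd [i _ /DeltaP[/nd]//]].
have ex : exists m : nat, [exists i : 'I_s, (m == i) && `[< divides (mu i) alpha >]].
  by exists i; apply/existsP; exists i; rewrite eqxx; exact/asboolP.
case: (ex_minnP ex) => m /existsP[j /andP[/eqP-> /asboolP dj]] min.
apply: nD; exists j => //; apply/DeltaP; split=> // j' lt dj'.
suff /min : [exists i : 'I_s, (val j' == i) && `[< divides (mu i) alpha >]].
  by rewrite leqNgt lt.
by apply/existsP; exists j'; rewrite eqxx; exact/asboolP.
Qed.

Definition element h : R := xget 0 [set r | c r = h].

Lemma elementK h : c (element h) = h.
Proof. exact: (xgetPex 0 (digits_realize D h)). Qed.

(* Every exponent lies in exactly one of the regions, so one function h encodes *)
(* all the quotients together with the remainder.                              *)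
Definition quotient_of h i : R :=
  element (fun b => if `[< Dlt i (b + mu i) >] then h (b + mu i) else 0).

Definition remainder_of h : R :=
  element (fun b => if `[< Dbar b >] then h b else 0).

Definition combination h : R :=
  \sum_(i < s) quotient_of h i * tnth G i + remainder_of h.

(** The i-th quotient can change only at exponents that translation by [mu i] sends into [U], and
    the support of the i-th generator starts at [mu i]. *)
Lemma combination_agree U h h' : upset le U ->
  (forall beta, ~ U beta -> h beta = h' beta) ->
  supported c U (combination h - combination h').
Proof.
move=> upU E; rewrite /combination opprD addrACA -sumrB.
apply: (supportedD D mo) => //; last first.
  apply: (supported_agree D mo) => // alpha nU; rewrite !elementK.
  by case: ifP => // _; exact: E.
apply: (supported_sum D mo) => // i _; rewrite -mulrBl.
have upV : upset le [set b | U (b + mu i)].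
  by move=> b b' Ub bb'; apply: upU Ub _; exact: (le_add2 ato).
apply: (supportedM D mo) => // a b ra gb.
have Ua : [set b | U (b + mu i)] a.
  apply: (supported_agree D mo upV _ ra) => d nU; rewrite !elementK.
  by case: ifP => // _; exact: E.
apply: upU Ua _; rewrite ![a + _]addrC; apply: (le_add2 ato).
exact: (LMP D mo (G_neq0 i)).2.
Qed.

Definition update h alpha d beta := if beta == alpha then d else h beta.

Lemma element_update h alpha d : h alpha = 0 ->
  element (update h alpha d) = element h + e d * monomial x alpha.
Proof.
move=> h0; apply: (digits_inj D) => beta; rewrite (digits_add_disjoint D) => [|b].
  rewrite !elementK (digit_term D) /update eq_sym.
  by case: eqP => [<-|_]; rewrite ?h0 ?add0r ?addr0.
rewrite elementK (digit_term D); case: (alpha =P b) => [<-|_]; [by left|by right].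
Qed.

(** Since [alpha] lies in exactly one region, the update touches one summand: [X] is a monomial
    times a generator, with leading exponent [alpha], or the monomial of [alpha] itself in the
    remainder. As the old digit is 0, no carry occurs. *)
Lemma combination_update h alpha : h alpha = 0 ->
  exists X, [/\ supported c (le alpha) X, c X alpha != 0 &
    forall d, combination (update h alpha d) = combination h + e d * X].
Proof.
move=> h0; have [[i Di]|nD] := pselect (exists i, Dlt i alpha).
  have [alpha' E] : exists alpha', alpha = alpha' + mu i.
    have [/(upclosure1P (mu i) alpha)[_ -> [g ->]] _] := (DeltaP i alpha).1 Di.
    by exists g; rewrite addrC.
  have [lead supp'] := monomial_mul_lead D mo alpha' (G_neq0 i).
  exists (monomial x alpha' * tnth G i); split; rewrite ?E // => d.
  rewrite /combination (bigD1 i) //= [in RHS](bigD1 i) //=.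
  have -> : quotient_of (update h (alpha' + mu i) d) i =
      quotient_of h i + e d * monomial x alpha'.
    rewrite -element_update; last by case: ifP; rewrite -?E.
    congr element; apply/funext => b; rewrite /update (inj_eq (@multi_addIr _ (mu i))).
    by case: eqVneq => // ->; rewrite -E asboolT.
  have -> : remainder_of (update h (alpha' + mu i) d) = remainder_of h.
    congr element; apply/funext => b; rewrite /update -E.
    case: eqVneq => // ->; case: asboolP => // nD.
    by case: nD; exists i.
  under eq_bigr => j ji.
    have -> : quotient_of (update h (alpha' + mu i) d) j = quotient_of h j.
      congr element; apply/funext => b; rewrite /update -E.
      case: eqVneq => // ->; case: asboolP => // Dj.
      by rewrite (Delta_inj Dj Di) eqxx in ji.
    over.
  by rewrite mulrDl -mulrA -!addrA; congr (_ + _); rewrite addrC addrA.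
exists (monomial x alpha); split=> [b||d].
- rewrite (digit_monomial D); case: (alpha =P b) => [<- _|_] /=; last by rewrite eqxx.
  exact: (ato_refl ato).
- by rewrite (digit_monomial D) eqxx oner_eq0.
rewrite /combination -addrA; congr (_ + _).
  apply: eq_bigr => j _; congr (element _ * _); apply/funext => b; rewrite /update.
  case: eqVneq => // E; case: asboolP => // Dj.
  by case: nD; exists j; rewrite -E.
rewrite -element_update; last by rewrite h0; case: ifP.
congr element; apply/funext => b; rewrite /update.
case: eqVneq => // ->; rewrite asboolT // => -[i _ Di].
by apply: nD; exists i.
Qed.

(** * Transfinite recursion on the exponents *)

Section Recursion.
Variable f : R.

(** All digits from [alpha] on are reset to 0, and the one at [alpha] is chosen to make the error
    vanish up to and including [alpha]. The proof of [division_digit_spec] shows that such a digit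
    exists. *)
Definition digit_step alpha (rec : forall beta, strict le beta alpha -> k) : k :=
  let h beta := if pselect (strict le beta alpha) is left lt then rec beta lt else 0 in
  xget 0 [set d | supported c (strict le alpha)
                    (f - combination (update h alpha d))].

Definition division_digit : multi n -> k :=
  Fix (order_wf ato) (fun=> k) digit_step.

Definition cut alpha h beta := if strict le beta alpha then h beta else 0.

Lemma division_digitE alpha : division_digit alpha =
  xget 0 [set d | supported c (strict le alpha)
    (f - combination (update (cut alpha division_digit) alpha d))].
Proof.
rewrite /division_digit Fix_eq; last first.
  move=> a r r' E; congr digit_step.
  by apply/functional_extensionality_dep => b; apply/funext => lt; exact: E.
congr (xget 0 _); apply/funext => d /=; congr (supported c _ (f - combination _)).
apply/funext => b; rewrite /update /cut; case: eqP => // _.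
by case: pselect => lt; [rewrite lt|case: ifP].
Qed.

Lemma division_digit_spec alpha : supported c (strict le alpha)
  (f - combination (update (cut alpha division_digit) alpha (division_digit alpha))).
Proof.
elim/(well_founded_ind (order_wf ato)): alpha => alpha IH.
set h := cut alpha division_digit.
have h0 : h alpha = 0 by rewrite /h /cut /strict eqxx.
(* Up to and including an earlier [beta], the digits in [h] are those of stage [beta], so the error
   at [beta] is already known to vanish. *)
have Sf : supported c (le alpha) (f - combination h).
  move=> beta ne; apply: contraPT ne => nab.
  have lt : strict le beta alpha by rewrite strictE.
  suff S : supported c (strict le beta) (f - combination h).
    by apply/negP; rewrite negbK; apply/eqP/(supported_out S); rewrite /strict eqxx.
  have := IH _ lt; set h' := update _ _ _ => S'.
  have -> : f - combination h =
      (f - combination h') + (combination h' - combination h).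
    by rewrite addrA subrK.
  apply: (supportedD D mo) => //; first exact: (upset_strict mo).
  apply: combination_agree; first exact: (upset_strict mo).
  move=> g nlt; rewrite /h' /update /h /cut; case: eqP => [->|ne]; first by rewrite lt.
  have gb : strict le g beta.
    rewrite strictE //; apply/negP => bg; apply: nlt; rewrite /strict bg andbT.
    by apply/eqP => E; apply: ne.
  by rewrite gb (strict_le_trans ato gb) //; case/andP: lt.
(* A digit at [alpha] changes the combination by a scalar multiple of [X], and the scalar can be
   chosen to cancel the error at [alpha]. *)
have [X [SX nX upd]] := combination_update h0.
have [d Sd] := lead_cancel D mo Sf SX nX.
have ex : exists d, supported c (strict le alpha) (f - combination (update h alpha d)).
  by exists d; rewrite upd opprD addrA.
rewrite division_digitE -/h; exact: (xgetPex 0 ex).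
Qed.

(** At each [alpha] the full digit function agrees with that of stage [alpha] through [alpha]
    itself, so the error has no digit there. *)
Lemma division_exists : f = combination division_digit.
Proof.
apply/eqP; rewrite -subr_eq0; apply/eqP/(digits_inj D) => alpha.
rewrite (digit0 D); apply: (@supported_out _ _ _ c (strict le alpha)); last first.
  by rewrite /strict eqxx.
have := @division_digit_spec alpha; set h' := update _ _ _ => S'.
have -> : f - combination division_digit =
    (f - combination h') + (combination h' - combination division_digit).
  by rewrite addrA subrK.
apply: (supportedD D mo) => //; first exact: (upset_strict mo).
apply: combination_agree; first exact: (upset_strict mo).
move=> g nlt; rewrite /h' /update /cut; case: eqP => [->//|ne].
suff -> : strict le g alpha by [].
rewrite strictE //; apply/negP => bg; apply: nlt; rewrite /strict bg andbT.
by apply/eqP => E; apply: ne.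
Qed.

End Recursion.

Lemma right_division_exists f : exists r q, right_division e x le G f q r.
Proof.
exists (remainder_of (division_digit f)), (quotient_of (division_digit f)).
split=> [|i alpha /(suppE D)|alpha /(suppE D)]; first exact: division_exists.
  by rewrite elementK; case: asboolP => // _; rewrite eqxx.
by rewrite elementK; case: asboolP => // _; rewrite eqxx.
Qed.

End Division.

(** * Ideal membership by division *)

Lemma left_ideal_sum (R : unitRingType) (I : set R) s (q : 'I_s -> R) (G : s.-tuple R) :
  left_ideal I -> (forall i, I (tnth G i)) -> I (\sum_(i < s) q i * tnth G i).
Proof.
move=> hI IG; elim/big_ind: _ => [|a b|i _]; first exact: li_0 hI.
  exact: li_add hI _ _.
exact: li_mul hI _ _ (IG i).
Qed.

Theorem corollary5p4 (p n : nat) (k : finFieldType) (R : unitRingType)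
    (e : k -> R) (x : n.-tuple R)
    (hR : iterated_local_skew_power_series_ring p e x)
    (le : rel {ffun 'I_n -> nat}) (hle : monomial_order e x le)
    (I : set R) (hI : left_ideal I)
    (s : nat) (G : s.-tuple R) (hG : groebner_basis e x le I G) (f : R) :
  I f <-> remainder e x le G f = 0.
Proof.
have [c D] : exists c : R -> multi n -> k, digit_system e x c.
  by have := digit_system_iterated_series hR; rewrite size_tuple.
have [[GI Igen] LMI] := hG.
(* As some division exists, the element chosen by [remainder] is the remainder of an actual
   division. *)
have [q [fE qD rD]] : exists q, right_division e x le G f q (remainder e x le G f).
  exact: (xgetPex 0 (right_division_exists D hle (fun i => (GI i).2) f)).
have IG i := (GI i).1.
set r := remainder _ _ _ _ _ in fE rD *; split=> [If|r0]; last first.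
  by rewrite fE r0 addr0; exact: left_ideal_sum.
have Ir : I r.
  have -> : r = -1 * (\sum_(i < s) q i * tnth G i) + f.
    by rewrite fE mulN1r addrA addNr add0r.
  by apply: (li_add hI) => //; apply: (li_mul hI); exact: left_ideal_sum.
apply: contrapT => /eqP r0; have [lr _] := LMP D hle r0.
(* The support condition forbids every generator's leading exponent to divide LM(r), whereas
   membership in [I] and the Groebner property require one that does. *)
have /(suppE D)/rD/Delta_barP nd := lr.
have : LMset e x le I (LM e x le r) by exists r => //; split=> //; exact/eqP.
rewrite LMI => -[_ [g [/= /tnthP[i ->] _] <-] [gamma E]]; apply: (nd i).
by apply/upclosure1P; exists (LM e x le (tnth G i)) => //; exists gamma.
Qed.
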